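(* Suppose $\Phi$ is not simply laced, let $\theta_s$ be the highest short root of $\Phi$ and let $I(\theta_s)=\{i\in\{1,\dots,n\}\mid c_i(\theta_s)=m_i\}$. Then the minimal dimension of the faces of $\mathcal P_\Phi$ containing a short root is $n-|I(\theta_s)|$. Moreover, the faces of dimension $n-|I(\theta_s)|$ containing a short root form a single $W$-orbit.
   Context: $\Phi$ is a finite irreducible reduced crystallographic root system of rank $n$ in the Euclidean space $\mathrm{Span}_{\mathbb R}\Phi$; $\Pi=\{\alpha_1,\dots,\alpha_n\}$ is a root basis, $W$ the Weyl group, $\theta=\sum_{i=1}^n m_i\alpha_i$ the highest root. For a root $\alpha$, $c_i(\alpha)$ is the coefficient of $\alpha_i$ in $\alpha=\sum_i c_i(\alpha)\alpha_i$. $\mathcal P_\Phi$ is the convex hull of $\Phi$, and $\mathcal P_\Phi$ is regarded as a face of itself (of dimension $n$). *)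

(* Defs.v *)
From HB Require Import structures.
From mathcomp Require Import all_boot all_order all_algebra finmap.
From mathcomp Require Import boolp classical_sets reals convex.

Set Implicit Arguments.
Unset Strict Implicit.
Unset Printing Implicit Defensive.

Import Order.TTheory GRing.Theory Num.Theory.

Local Open Scope classical_set_scope.
Local Open Scope ring_scope.

Section RootSystems.
(* The ambient Euclidean space is a finite-dimensional real vector space E with
   a positive definite symmetric bilinear form ip; rs_span below makes it the
   span of Phi, so that the rank of Phi is \dim {:E}. *)
Variables (R : realType) (E : vectType R) (ip : {dot E for idfun}).
Implicit Types (Phi : {fset E}) (a b : E).

Definition reflection a (x : E) : E := x - (2 * ip x a / ip a a) *: a.

Record root_system Phi : Prop := RootSystem {
  rs_span : <<Phi>>%VS = fullv;
  rs_nonzero : 0 \notin Phi;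
  rs_reflection : forall a b, a \in Phi -> b \in Phi -> reflection a b \in Phi;
  rs_crystallographic : forall a b, a \in Phi -> b \in Phi ->
    2 * ip b a / ip a a \is a Num.int;
  rs_reduced : forall a (t : R), a \in Phi -> t *: a \in Phi -> t = 1 \/ t = -1
}.

Definition irreducible_roots Phi : Prop :=
  Phi <> fset0 /\
  forall S : {fset E}, (S `<=` Phi)%fset ->
    (forall a b, a \in S -> b \in (Phi `\` S)%fset -> ip a b = 0) ->
    S = fset0 \/ S = Phi.

Definition simply_laced Phi : Prop :=
  forall a b, a \in Phi -> b \in Phi -> ip a a = ip b b.

(* If all roots have the same length they are all long, as usual. *)
Definition short_root Phi b : Prop :=
  b \in Phi /\ exists2 a, a \in Phi & ip b b < ip a a.

Section Basis.
Variables (n : nat) (Pi : n.-tuple E).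

Record root_basis Phi : Prop := RootBasis {
  rb_basis : basis_of fullv Pi;
  rb_roots : {subset Pi <= Phi};
  rb_sign : forall b, b \in Phi ->
    (forall i, coord Pi i b \is a Num.nat) \/
    (forall i, coord Pi i (- b) \is a Num.nat)
}.

(* b - a is a sum of simple roots *)
Definition root_le a b : Prop := forall i, coord Pi i (b - a) \is a Num.nat.

Definition highest_root Phi (theta : E) : Prop :=
  theta \in Phi /\ forall b, b \in Phi -> root_le b theta.

Definition highest_short_root Phi (theta_s : E) : Prop :=
  short_root Phi theta_s /\ forall b, short_root Phi b -> root_le b theta_s.

(* The indices i such that c_i(b) = c_i(theta); with theta the highest root,
   c_i(theta) = m_i. *)
Definition full_indices (theta b : E) : {set 'I_n} :=
  [set i | coord Pi i b == coord Pi i theta]%SET.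

End Basis.

(* Products of reflections: since reflections are involutions, these form the
   group generated by them. *)
Inductive weyl_group Phi : set (E -> E) :=
| weyl_id : weyl_group Phi id
| weyl_refl a w : a \in Phi -> weyl_group Phi w ->
    weyl_group Phi (reflection a \o w).

Definition weyl_orbit Phi (F : set E) : set (set E) :=
  [set w @` F | w in weyl_group Phi].

Definition root_polytope Phi : set E := smallest (@convex_set R E) [set` Phi].

(* Intersections of P with a supporting hyperplane; v = 0, c = 0 gives the face
   P itself (and v = 0, c = 1 the empty face). *)
Definition face (P F : set E) : Prop :=
  exists (v : E) (c : R),
    (forall x, P x -> ip v x <= c) /\ F = P `&` [set x | ip v x = c].

Definition affine_hull (A : set E) : set E :=
  [set x | exists k (t : 'I_k -> R) (p : 'I_k -> E),
    [/\ forall i, A (p i), \sum_i t i = 1 & x = \sum_i t i *: p i]].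

(* A has dimension d: its affine hull is a translate of a d-dimensional linear
   subspace. *)
Definition affine_dim (A : set E) (d : nat) : Prop :=
  exists (x : E) (U : {vspace E}),
    affine_hull A = [set x + u | u in [set` U]] /\ \dim U = d.

Definition short_face Phi (F : set E) : Prop :=
  face (root_polytope Phi) F /\ exists2 b, short_root Phi b & F b.

End RootSystems.

(* Main.v *)
Require Import Defs.
From HB Require Import structures.
From mathcomp Require Import all_boot all_order all_algebra finmap.
From mathcomp Require Import boolp classical_sets interval_inference reals convex.
From mathcomp Require Import ring lra.

Set Implicit Arguments.
Unset Strict Implicit.
Unset Printing Implicit Defensive.

Import Order.TTheory GRing.Theory Num.Theory.

Local Open Scope classical_set_scope.
Local Open Scope ring_scope.

(* Let I = I(theta_s) and let F_I be the face of the points of the polytope whose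
   coordinates in I are those of theta; it contains theta_s.  A face containing
   a short root is, up to W, defined by a dominant v; as
   b <= theta_s <= theta for every short root b, v takes the same (maximal)
   value on theta_s and theta, so it is orthogonal to the simple roots outside
   I and the face contains F_I.  Since a face properly contained in another has
   smaller dimension, it remains to see that dim F_I = n - |I|: one descends
   from theta to theta_s through roots by subtracting simple roots, all these
   roots lie in F_I, and every simple root outside I gets subtracted. *)

(** * Affine hulls and affine dimension *)

Section AffineHull.
Variables (R : realType) (E : vectType R).
Implicit Types (A B : set E) (x p q : E) (t : R).

Let fcons (T : Type) k (a : T) (f : 'I_k -> T) (i : 'I_k.+1) : T :=
  oapp f a (unlift ord0 i).

(** [G] is kept arbitrary so that one splitting serves both the sum of the weights and the weighted
    sum of the points. *)
Let sum_fcons k (V : zmodType) (G : R -> E -> V) s (t : 'I_k -> R) p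
    (q : 'I_k -> E) :
  \sum_i G (fcons s t i) (fcons p q i) = G s p + \sum_i G (t i) (q i).
Proof.
rewrite big_ord_recl /fcons unlift_none /=; congr (_ + _).
by apply: eq_bigr => i _; rewrite liftK.
Qed.

Lemma affine_hull_sub A : A `<=` affine_hull A.
Proof.
move=> x Ax; exists 1%N, (fun=> 1), (fun=> x).
by split => //; rewrite big_ord1 ?scale1r.
Qed.

Lemma affine_hullS A B : A `<=` B -> affine_hull A `<=` affine_hull B.
Proof.
by move=> AB x [k [t [p [Ap t1 ->]]]]; exists k, t, p; split => // i; apply: AB.
Qed.

(** Appending [p] and [q] with weights [s] and [- s] leaves the total weight equal to 1. *)
Lemma affine_hull_addB A x p q s :
  affine_hull A x -> A p -> A q -> affine_hull A (x + s *: (p - q)).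
Proof.
move=> [k [t [r [Ar t1 ->]]]] Ap Aq.
exists k.+2, (fcons s (fcons (- s) t)), (fcons p (fcons q r)); split.
- move=> i; rewrite /fcons; case: (unlift ord0 i) => //= j.
  by case: (unlift ord0 j) => /=.
- have /= -> := sum_fcons (fun a _ => a) s (fcons (- s) t) p (fcons q r).
  have /= -> := sum_fcons (fun a _ => a) (- s) t q r.
  by rewrite t1 addrA subrr add0r.
- rewrite (sum_fcons (fun a b => a *: b)) (sum_fcons (fun a b => a *: b)).
  by rewrite scalerBr scaleNr addrC addrA.
Qed.

Lemma affine_hull_add_sum A x (I : finType) (P : pred I) (c : I -> R)
    (e : I -> E) :
  affine_hull A x ->
  (forall j, P j -> exists p q, [/\ A p, A q & e j = p - q]) ->
  affine_hull A (x + \sum_(j | P j) c j *: e j).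
Proof.
move=> hx he; rewrite addrC; elim/big_rec: _ => [|j y Pj hy]; first by rewrite add0r.
have [p [q [Ap Aq ->]]] := he j Pj.
by rewrite -addrA addrC; apply: affine_hull_addB.
Qed.

Lemma affine_hull_image (f : 'End(E)) A :
  affine_hull (f @` A) = f @` affine_hull A.
Proof.
apply/seteqP; split => x.
- move=> [k [t [p [Ap t1 ->]]]].
  have /choice[q Aq] i : exists y, A y /\ f y = p i.
    by have [y Ay <-] := Ap i; exists y.
  exists (\sum_i t i *: q i); first by exists k, t, q; split => // i; case: (Aq i).
  by rewrite linear_sum; apply: eq_bigr => i _; rewrite linearZ /=; case: (Aq i) => _ ->.
- move=> [_ [k [t [p [Ap t1 ->]]]] <-].
  exists k, t, (f \o p); split => //; first by move=> i; exists (p i).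
  by rewrite linear_sum; apply: eq_bigr => i _; rewrite linearZ.
Qed.

Lemma affine_dim_image (f : 'End(E)) A d :
  injective f -> affine_dim A d -> affine_dim (f @` A) d.
Proof.
move=> finj [x [U [hA dU]]]; exists (f x), (f @: U)%VS; split; last first.
  by rewrite limg_dim_eq // (eqP (_ : lker f == 0%VS)) ?capv0 //; apply/lker0P.
rewrite affine_hull_image hA; apply/seteqP; split => y.
- move=> [_ [u uU <-] <-]; rewrite linearD; exists (f u) => //=.
  exact: memv_img.
- move=> [_ /= /memv_imgP[u uU ->] <-].
  by exists (x + u); [exists u | rewrite linearD].
Qed.

(** Inclusion of the hulls gives inclusion of their direction spaces, and equal dimensions make
    these coincide. *)
Lemma affine_dim_leqif A B d d' :
  A `<=` B -> affine_dim A d -> affine_dim B d' ->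
  (d <= d')%N /\ (d = d' -> affine_hull B = affine_hull A).
Proof.
move=> /affine_hullS AB [x [U [hA dU]]] [y [V [hB dV]]].
have trV u : u \in U -> exists2 v, v \in V & x + u = y + v.
  move=> uU; have /AB : affine_hull A (x + u) by rewrite hA; exists u.
  by rewrite hB => -[v vV <-]; exists v.
(* [v0] is the displacement between the two base points, [x = y + v0]. *)
have [v0 v0V] := trV 0 (mem0v _); rewrite addr0 => xE.
have UV : (U <= V)%VS.
  apply/subvP => u /trV[v vV]; rewrite xE -addrA => /addrI uE.
  by rewrite -(addKr v0 u) uE addrC rpredB.
split; first by rewrite -dU -dV dimvS.
rewrite -dU -dV => dUV; have {}UV : U = V by apply/eqP; rewrite eqEdim UV dUV /=.
apply/seteqP; split => // z; rewrite hB hA => -[v /= vV <-].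
exists (v - v0); first by rewrite /= UV rpredB.
by rewrite xE -addrA [v0 + _]addrC subrK.
Qed.

End AffineHull.

(** * Reflections and the root polytope *)

Section Polytope.
Variables (R : realType) (E : vectType R) (ip : {dot E for idfun}).
Variables (Phi : {fset E}).
Implicit Types (a b x y v : E).

Lemma ipC x y : ip x y = ip y x.
Proof. by have := hermC ip x y; rewrite expr0 mul1r. Qed.

Lemma ip_gt0 x : x != 0 -> 0 < ip x x.
Proof. exact: neq0_dnorm_gt0. Qed.

Lemma ip_eq0 x : ip x x = 0 -> x = 0.
Proof. by move=> xx; apply: contra_eq xx => /ip_gt0 /lt0r_neq0. Qed.

Lemma reflectionE a x y :
  ip (reflection ip a x) y = ip x y - 2 * ip x a / ip a a * ip a y.
Proof. by rewrite /reflection linearBl linearZl_LR. Qed.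

Lemma reflection_self a : a != 0 -> reflection ip a a = - a.
Proof.
move=> /ip_gt0 a0; rewrite /reflection mulfK ?gt_eqF //.
by rewrite scaler_nat mulr2n opprD addNKr.
Qed.

Lemma reflectionK a : a != 0 -> involutive (reflection ip a).
Proof.
move=> /ip_gt0 a0 x; rewrite {1}/reflection reflectionE.
rewrite /reflection -addrA -opprD -scalerDl.
have -> : 2 * ip x a / ip a a + 2 * (ip x a - 2 * ip x a / ip a a * ip a a) / ip a a = 0.
  by field; rewrite gt_eqF.
by rewrite scale0r subr0.
Qed.

Lemma reflection_adj a x y :
  ip (reflection ip a x) y = ip x (reflection ip a y).
Proof.
rewrite reflectionE /reflection linearBr linearZr_LR /= (ipC y a).
by ring.
Qed.

(** The preimage under [f] of a convex set containing the roots is again such a set. *)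
Lemma root_polytope_image (f : 'End(E)) :
  {homo f : x / x \in Phi} ->
  forall x, root_polytope Phi x -> root_polytope Phi (f x).
Proof.
move=> fPhi x Px A [cA PhiA]; rewrite -[A (f x)]/((f @^-1` A) x).
apply: Px; split; last by move=> b /= bPhi; apply/PhiA/fPhi.
move=> y z t; rewrite !inE /= => Ay Az.
rewrite [f _](_ : _ = conv t (f y : convex_lmodType E) (f z : convex_lmodType E)).
  by rewrite -inE; apply: cA; rewrite inE.
by rewrite /conv /= linearD !linearZ.
Qed.

Lemma i01_bounds (t : {i01 R}) : 0 <= t%:num <= 1.
Proof. by rewrite ge0 le1. Qed.

Lemma root_polytope_le (l : {scalar E}) (c : R) :
  (forall b, b \in Phi -> l b <= c) -> forall x, root_polytope Phi x -> l x <= c.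
Proof.
move=> lc; apply: (@smallest_sub _ _ _ [set x | l x <= c]) => //.
move=> y z t; rewrite !inE /= => ly lz.
rewrite linearD !linearZ /= /unstable.onem; set r := t%:num.
have /andP[r0 r1] : 0 <= r <= 1 by exact: i01_bounds.
have : r * l y + (1 - r) * l z <= r * c + (1 - r) * c.
  by rewrite lerD ?ler_wpM2l ?subr_ge0.
by rewrite -mulrDl subrKC mul1r.
Qed.

End Polytope.

(** * The Weyl group acting on roots, polytope and faces *)

Section WeylGroup.
Variables (R : realType) (E : vectType R) (ip : {dot E for idfun}).
Variables (Phi : {fset E}).
Hypothesis hPhi : root_system ip Phi.
Implicit Types (a b x y v : E) (w : E -> E) (F : set E).
Local Notation P := (root_polytope Phi).

Lemma root_neq0 a : a \in Phi -> a != 0.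
Proof. by apply: contraTneq => ->; apply: rs_nonzero hPhi. Qed.

Lemma root_opp a : a \in Phi -> - a \in Phi.
Proof.
move=> aPhi; rewrite -(reflection_self ip (root_neq0 aPhi)).
exact: (rs_reflection hPhi).
Qed.

Lemma int_eq1_or_ge2 (m : R) : m \is a Num.int -> 0 < m -> m = 1 \/ 2 <= m.
Proof.
move=> /intrP[k ->]; rewrite ltr0z => k0.
case: (ltgtP k 1) => k1; [|right|left; by rewrite k1].
  by move: k1; rewrite -[1]add0r ltzD1 leNgt k0.
by rewrite -[2]/(2%:~R) ler_int.
Qed.

(** Both Cartan integers are positive. If one is 1, a reflection yields [a - b] up to sign; if both
    are at least 2, then [ip a b] bounds both square lengths and [a - b] has square length at most
    0. *)
Lemma root_sub a b :
  a \in Phi -> b \in Phi -> a != b -> 0 < ip a b -> a - b \in Phi.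
Proof.
move=> aP bP neq ab.
have a0 := ip_gt0 ip (root_neq0 aP); have b0 := ip_gt0 ip (root_neq0 bP).
have ba : 0 < ip b a by rewrite ipC.
have ka : 0 < 2 * ip a b / ip b b by rewrite divr_gt0 ?mulr_gt0.
have kb : 0 < 2 * ip b a / ip a a by rewrite divr_gt0 ?mulr_gt0.
have [k1|k2] := int_eq1_or_ge2 (rs_crystallographic hPhi bP aP) ka.
  have := rs_reflection hPhi bP aP.
  by rewrite /reflection k1 scale1r.
have [l1|l2] := int_eq1_or_ge2 (rs_crystallographic hPhi aP bP) kb.
  have := root_opp (rs_reflection hPhi aP bP).
  by rewrite /reflection l1 scale1r opprB.
have : 0 < ip (a - b) (a - b) by rewrite ip_gt0 // subr_eq0.
rewrite linearBl !linearBr /= (ipC ip b a).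
move: k2 l2; rewrite !ler_pdivlMr // (ipC ip b a); lra.
Qed.

Lemma weyl_group_comp w1 w2 :
  weyl_group ip Phi w1 -> weyl_group ip Phi w2 -> weyl_group ip Phi (w1 \o w2).
Proof. by elim=> // a w aP _ IH /IH; apply: weyl_refl. Qed.

(** The inverse is the product of the same reflections in reverse order. *)
Lemma weyl_group_inv w : weyl_group ip Phi w ->
  exists w', [/\ weyl_group ip Phi w', cancel w w' & cancel w' w].
Proof.
elim=> [|a u aP _ [u' [wu' uK u'K]]]; first by exists id; split => //; apply: weyl_id.
have rK := reflectionK ip (root_neq0 aP).
exists (u' \o reflection ip a); split.
- apply: weyl_group_comp => //.
  exact: (weyl_refl aP (@weyl_id _ _ ip Phi)).
- by move=> x /=; rewrite rK uK.
- by move=> x /=; rewrite u'K rK.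
Qed.

Lemma weyl_group_root w b : weyl_group ip Phi w -> b \in Phi -> w b \in Phi.
Proof. by move=> + bP; elim=> // a u aP _ uP; apply: (rs_reflection hPhi). Qed.

Lemma weyl_group_isometry w x y :
  weyl_group ip Phi w -> ip (w x) (w y) = ip x y.
Proof.
elim=> // a u aP _ <- /=.
by rewrite reflection_adj reflectionK // root_neq0.
Qed.

Lemma reflection_linear a : linear (reflection ip a).
Proof.
move=> t x y; rewrite /reflection linearDl linearZl_LR /=.
rewrite scalerBr addrACA scalerA -opprD -scalerDl.
by congr (_ - _ *: _); ring.
Qed.

(** Weyl group elements are bare functions; this gives access to the results on images under
    endomorphisms. *)
Lemma weyl_group_linear w : weyl_group ip Phi w -> exists f : 'End(E), f =1 w.
Proof.
elim=> [|a u aP _ [f fE]]; first by exists \1%VF => x; rewrite id_lfunE.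
pose r := GRing.isLinear.Build R E E _ _ (reflection_linear a).
pose g : {linear E -> E} := HB.pack (reflection ip a) r.
by exists (linfun g \o f)%VF => x; rewrite comp_lfunE lfunE fE.
Qed.

Lemma weyl_group_polytope w x : weyl_group ip Phi w -> P x -> P (w x).
Proof.
move=> ww; have [f fE] := weyl_group_linear ww; rewrite -fE.
by apply: root_polytope_image => b bP; rewrite fE; apply: weyl_group_root.
Qed.

Lemma weyl_group_affine_dim w F d :
  weyl_group ip Phi w -> affine_dim F d -> affine_dim (w @` F) d.
Proof.
move=> ww; have [f fE] := weyl_group_linear ww.
have [w' [_ wK _]] := weyl_group_inv ww.
have -> : w = f by apply: funext => x; rewrite fE.
by apply: affine_dim_image; apply: (@can_inj _ _ _ w') => x; rewrite fE wK.
Qed.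

Lemma weyl_group_face w v c : weyl_group ip Phi w ->
  w @` (P `&` [set x | ip v x = c]) = P `&` [set x | ip (w v) x = c].
Proof.
move=> ww; have [w' [ww' wK w'K]] := weyl_group_inv ww.
apply/seteqP; split => [_ [x [Px vx] <-]|x [Px vx]].
  by split; [apply: weyl_group_polytope | rewrite /= weyl_group_isometry].
exists (w' x); last exact: w'K.
split; first exact: weyl_group_polytope.
by rewrite /= -(weyl_group_isometry _ _ ww) w'K.
Qed.

Lemma weyl_group_short w b :
  weyl_group ip Phi w -> short_root ip Phi b -> short_root ip Phi (w b).
Proof.
move=> ww [bP [a aP lt_ba]]; split; first exact: weyl_group_root.
by exists a; rewrite ?weyl_group_isometry.
Qed.

Lemma weyl_group_short_face w F :
  weyl_group ip Phi w -> short_face ip Phi F -> short_face ip Phi (w @` F).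
Proof.
move=> ww [[v [c [Pc ->]]] [b sb [Pb vb]]]; split.
  exists (w v), c; split; last exact: weyl_group_face.
  move=> x Px; have [w' [ww' wK w'K]] := weyl_group_inv ww.
  by rewrite -(w'K x) weyl_group_isometry // Pc //; apply: weyl_group_polytope.
by exists (w b); [apply: weyl_group_short | exists b].
Qed.

End WeylGroup.

(** * Positive roots and dominant vectors *)

Section Dominance.
Variables (R : realType) (E : vectType R) (ip : {dot E for idfun}).
Variables (Phi : {fset E}) (n : nat) (Pi : n.-tuple E).
Hypotheses (hPhi : root_system ip Phi) (hPi : root_basis Pi Phi).
Implicit Types (a b x y v : E).

Lemma simple_root i : (i < n)%N -> Pi`_i \in Phi.
Proof. by move=> ltin; apply/(rb_roots hPi)/mem_nth; rewrite size_tuple. Qed.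

Lemma coord_simple (i j : 'I_n) : coord Pi i Pi`_j = (i == j)%:R.
Proof. by rewrite coord_free ?(basis_free (rb_basis hPi)) // eq_sym. Qed.

Lemma coordE x : x = \sum_i coord Pi i x *: Pi`_i.
Proof. exact: coord_basis (rb_basis hPi) (memvf x). Qed.

Definition positive b : bool := [forall i, 0 <= coord Pi i b].

Lemma positive_or_opp b : b \in Phi -> positive b || positive (- b).
Proof.
move=> /(rb_sign hPi) [] h; apply/orP; [left|right];
by apply/forallP => i; apply: natr_ge0.
Qed.

(** Only coordinate [i] changes. A negative image would make the others vanish, so [b] would be a
    multiple of the simple root; reducedness leaves only the root itself and its opposite, both
    excluded. *)
Lemma positive_reflection (i : 'I_n) b :
  b \in Phi -> b != Pi`_i -> positive b -> positive (reflection ip Pi`_i b).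
Proof.
move=> bP neq /forallP pb.
have aP := simple_root (ltn_ord i).
have /orP[//|/forallP nb] := positive_or_opp (rs_reflection hPhi aP bP).
have c0 j : j != i -> coord Pi j b = 0.
  move=> neqji; apply: le_anti; rewrite pb andbT.
  have := nb j; rewrite /reflection linearN linearB linearZ /= coord_simple.
  by rewrite (negPf neqji) mulr0 subr0 oppr_ge0.
have bE : b = coord Pi i b *: Pi`_i.
  rewrite [LHS]coordE (bigD1 i) //= big1 ?addr0 // => j /c0 ->.
  by rewrite scale0r.
case: (rs_reduced hPhi aP (t := coord Pi i b)); first by rewrite -bE.
  by move=> b1; move: neq; rewrite bE b1 scale1r eqxx.
by move=> b1; have := pb i; rewrite b1 oppr_ge0 ler10.
Qed.

Definition dominant v := forall i : 'I_n, 0 <= ip v Pi`_i.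

(* The number of positive roots negative on [v] drops under a simple
   reflection in a root negative on [v]. *)
Lemma weyl_group_dominant v : exists2 w, weyl_group ip Phi w & dominant (w v).
Proof.
pose N u := [fset b in Phi | positive b && (ip u b < 0)]%fset.
have [k] := ubnP #|` N v|; elim: k v => // k IH v; rewrite ltnS => Nk.
have [dv|/existsNP[i /negP]] := pselect (dominant v).
  by exists id => //; apply: weyl_id.
rewrite -ltNge => vi; have aP := simple_root (ltn_ord i).
have a0 := root_neq0 hPhi aP; set s := reflection ip Pi`_i.
(* The injective [s] maps [N (s v)] into [N v] minus the simple root, which does lie in [N v]: hence
   the strict drop. *)
have sNP b : b \in N (s v) -> s b \in (N v `\ Pi`_i)%fset.
  rewrite !inE /= => /and3P[bP pb sb].
  have bneq : b != Pi`_i.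
    apply: contraTneq sb => ->; rewrite -leNgt /s reflection_adj.
    by rewrite reflection_self // linearNr oppr_ge0 ltW.
  rewrite (rs_reflection hPhi) // positive_reflection // -reflection_adj sb.
  rewrite !andbT; apply: contraTneq pb => sbE; apply/forallPn; exists i.
  rewrite -(reflectionK ip a0 b) -/s sbE /s reflection_self // linearN /=.
  by rewrite coord_simple eqxx oppr_ge0 ler10.
have [|w ww dw] := IH (s v); last first.
  exists (w \o s) => //; apply: weyl_group_comp => //.
  exact: weyl_refl aP (@weyl_id _ _ ip Phi).
apply: leq_trans Nk; rewrite (cardfsD1 Pi`_i (N v)).
have -> : Pi`_i \in N v.
  rewrite !inE /= aP vi andbT; apply/forallP => j.
  by rewrite coord_simple ler0n.
rewrite add1n ltnS.
have <- : #|` [fset s b | b in N (s v)]%fset| = #|` N (s v)|.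
  by rewrite card_imfset //; apply: can_inj (reflectionK ip a0).
by apply/fsubset_leq_card/fsubsetP => _ /imfsetP[b /= /sNP ? ->].
Qed.

(* The Gram matrix of a basis is invertible. *)
Lemma dual_vector (r : 'I_n -> R) : exists v, forall i : 'I_n, ip v Pi`_i = r i.
Proof.
pose G := \matrix_(i < n, j < n) ip Pi`_i Pi`_j.
have GE (u : 'rV_n) j : (u *m G) 0 j = ip (\sum_i u 0 i *: Pi`_i) Pi`_j.
  rewrite mxE linear_sumlz; apply: eq_bigr => i _.
  by rewrite linearZl_LR mxE.
have Gu : G \in unitmx.
  rewrite -row_free_unit; apply: inj_row_free => u uG.
  (* A combination [x] given by a kernel vector is orthogonal to every simple root, hence to
     itself. *)
  pose x := \sum_i u 0 i *: Pi`_i.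
  have x0 : x = 0.
    apply: (@ip_eq0 _ _ ip); rewrite {2}[x]coordE linear_sumr big1 // => j _.
    by rewrite linearZr_LR /= -GE uG mxE mulr0.
  apply/rowP => i; rewrite mxE.
  by rewrite -(coord_sum_free (u 0) i (basis_free (rb_basis hPi))) -/x x0 linear0.
exists (\sum_i ((\row_i r i) *m invmx G) 0 i *: Pi`_i) => i.
by rewrite -GE mulmxKV // mxE.
Qed.

Lemma ip_dominant_le v x y : dominant v ->
  (forall i, coord Pi i x <= coord Pi i y) -> ip v x <= ip v y.
Proof.
move=> dv xy; rewrite [x]coordE [y]coordE !linear_sumr; apply: ler_sum => i _.
by rewrite !linearZr_LR /= ler_wpM2r.
Qed.

End Dominance.

(** * The face F_I: dimension and minimality *)

Section StandardFace.
Variables (R : realType) (E : vectType R) (ip : {dot E for idfun}).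
Variables (Phi : {fset E}) (n : nat) (Pi : n.-tuple E) (theta theta_s : E).
Hypotheses (hPhi : root_system ip Phi) (hPi : root_basis Pi Phi).
Hypotheses (htheta : highest_root Pi Phi theta).
Hypotheses (htheta_s : highest_short_root ip Pi Phi theta_s).
Implicit Types (a b x y v : E).
Local Notation P := (root_polytope Phi).
Local Notation I := (full_indices Pi theta theta_s).

Lemma root_le_coord a b : root_le Pi a b -> forall i, coord Pi i a <= coord Pi i b.
Proof. by move=> ab i; have := natr_ge0 (ab i); rewrite linearB subr_ge0. Qed.

(** The simple reflection of [theta_s] is a short root, so its coordinate [i] cannot exceed that of
    [theta_s]. *)
Lemma short_dominant : dominant ip Pi theta_s.
Proof.
move=> i; have aP := simple_root hPi (ltn_ord i).
have a0 := ip_gt0 ip (root_neq0 hPhi aP).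
have [ss] := htheta_s => /(_ (reflection ip Pi`_i theta_s)).
have wr := weyl_refl aP (@weyl_id _ _ ip Phi).
move=> /(_ (weyl_group_short hPhi wr ss)) /root_le_coord /(_ i).
rewrite /reflection linearB linearZ /= (coord_simple hPi) eqxx mulr1.
by rewrite gerBl pmulr_lge0 ?invr_gt0 // pmulr_rge0.
Qed.

Lemma short_positive i : 0 <= coord Pi i theta_s.
Proof.
have [ss hs] := htheta_s.
have : short_root ip Phi (- theta_s).
  case: ss => [sP [a aP lt_a]]; split; first exact: (root_opp hPhi).
  by exists a => //; rewrite linearNl linearNr /= opprK.
move=> /hs /root_le_coord /(_ i); rewrite linearN /=; lra.
Qed.

(* If [b - theta_s] is a nonzero sum of simple roots, some simple root of its
   support has positive product with it, hence with [b] since [theta_s] is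
   dominant; so [b] minus that simple root is again a root above [theta_s]. *)
Lemma root_descent b : b \in Phi -> root_le Pi theta_s b -> b != theta_s ->
  exists i : 'I_n, b - Pi`_i \in Phi /\ root_le Pi theta_s (b - Pi`_i).
Proof.
move=> bP le_b neq; set x := b - theta_s.
have xx : 0 < ip x x by rewrite ip_gt0 // subr_eq0.
have [i xi] : exists i : 'I_n, 0 < coord Pi i x * ip x Pi`_i.
  apply/existsP; apply: contraLR xx => /existsPn h; rewrite -leNgt.
  rewrite {2}[x](coordE hPi) linear_sumr; apply: sumr_le0 => i _.
  by rewrite linearZr_LR /= leNgt.
have ci := root_le_coord le_b i; have xi0 : 0 <= coord Pi i x := natr_ge0 (le_b i).
have xi_neq0 : coord Pi i x != 0.
  by apply: contraTneq xi => ->; rewrite mul0r ltxx.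
have xi_ge1 : 1 <= coord Pi i x.
  have /natrP[k xk] : coord Pi i x \is a Num.nat := le_b i.
  by move: xi_neq0; rewrite xk pnatr_eq0 ler1n lt0n.
have bi : 0 < ip b Pi`_i.
  have : 0 < ip x Pi`_i by rewrite -(pmulr_rgt0 _ (lt_le_trans ltr01 xi_ge1)).
  by rewrite /x linearBl subr_gt0; apply/le_lt_trans/short_dominant.
have aP := simple_root hPi (ltn_ord i).
have le_bi : root_le Pi theta_s (b - Pi`_i).
  move=> j; rewrite addrAC linearB /= (coord_simple hPi).
  case: eqVneq => [->|_]; last by rewrite subr0; apply: le_b.
  have /natrP[k xk] : coord Pi i x \is a Num.nat := le_b i.
  by move: xi_ge1; rewrite -/x xk ler1n => k0; rewrite -natrB // natr_nat.
exists i; split => //; apply: (root_sub hPhi) => //.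
(* If [b] were this simple root, 0 would lie above [theta_s], whose coordinates are nonnegative, and
   [theta_s] would vanish. *)
apply: contraTneq (root_neq0 hPhi htheta_s.1.1) => bE; rewrite negbK.
rewrite [theta_s](coordE hPi) big1 // => j _.
have := root_le_coord le_bi j; rewrite bE subrr linear0 => sj.
by rewrite (_ : coord Pi j theta_s = 0) ?scale0r //; apply/le_anti; rewrite sj short_positive.
Qed.

(** Induction on the height of [b - theta_s]: the descent to [theta_s] must at some step subtract
    the simple root of index [i], and [p], [q] are the roots before and after that step. *)
Lemma root_chain b (i : 'I_n) :
  b \in Phi -> root_le Pi theta_s b -> coord Pi i b != coord Pi i theta_s ->
  exists p q, [/\ p \in Phi, q \in Phi, root_le Pi theta_s p,
                  root_le Pi theta_s q & Pi`_i = p - q].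
Proof.
move=> bP le_b.
have [k] : exists k, \sum_j coord Pi j (b - theta_s) = k%:R.
  by apply/natrP/rpred_sum => j _; apply: le_b.
elim: k b bP le_b => [|k IH] b bP le_b sum_b neqi.
  have x0 := psumr_eq0P (fun j _ => natr_ge0 (le_b j)) sum_b.
  have := x0 i isT.
  by rewrite linearB => /eqP; rewrite subr_eq0 (negPf neqi).
have [j [bjP le_bj]] : exists j : 'I_n, b - Pi`_j \in Phi /\ root_le Pi theta_s (b - Pi`_j).
  by apply: root_descent => //; apply: contraNneq neqi => ->.
have [->|neq_ij] := eqVneq i j.
  by exists b, (b - Pi`_j); split => //; rewrite subKr.
apply: (IH _ bjP le_bj); last first.
  by rewrite linearB /= (coord_simple hPi) (negPf neq_ij) subr0.
under eq_bigr do rewrite addrAC linearB /= (coord_simple hPi).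
rewrite sumrB sum_b (bigD1 j) //= eqxx big1 ?addr0.
  by rewrite -natr1 addrK.
by move=> m /negPf ->.
Qed.

(* For such a [v], [standard_face v] below is the face F_I. *)
Definition coface_vector v :=
  forall i : 'I_n, ip v Pi`_i = (i \in I)%:R.

Lemma coface_vectorE v x : coface_vector v ->
  ip v x = \sum_(i in I) coord Pi i x.
Proof.
move=> hv; rewrite [in LHS](coordE hPi x) linear_sumr [RHS]big_mkcond /=.
apply: eq_bigr => i _; rewrite linearZr_LR /= hv.
by case: (i \in I); rewrite ?mulr1 ?mulr0.
Qed.

Lemma polytope_coord_le x i : P x -> coord Pi i x <= coord Pi i theta.
Proof.
apply: root_polytope_le => b bP; apply: root_le_coord.
by case: htheta => _; apply.
Qed.

Lemma polytope_ip_le v x : dominant ip Pi v -> P x -> ip v x <= ip v theta.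
Proof.
by move=> dv Px; apply: (ip_dominant_le hPi) => // i; apply: polytope_coord_le.
Qed.

Lemma root_polytopeP b : b \in Phi -> P b.
Proof. by move=> bP; apply: sub_gen_smallest. Qed.

Definition standard_face v := P `&` [set x | ip v x = ip v theta].

(** On the polytope no coordinate exceeds that of [theta], so equality of the sums over [I] holds
    term by term. *)
Lemma standard_faceP v x : coface_vector v ->
  standard_face v x <-> P x /\ forall i, i \in I -> coord Pi i x = coord Pi i theta.
Proof.
move=> hv; rewrite /standard_face /= !(coface_vectorE _ hv).
split=> [[Px] /eqP|[Px xE]]; last by split => //=; apply: eq_bigr.
rewrite /= => xE; split => // i iI.
have [_] := leif_sum (fun i (_ : i \in I) => leif_eq (polytope_coord_le i Px)).
by rewrite xE => /esym/forall_inP/(_ i iI)/eqP.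
Qed.

(** Coordinates in [I] are squeezed between those of [theta_s] and [theta], which agree there. *)
Lemma above_short_standard_face v b : coface_vector v ->
  b \in Phi -> root_le Pi theta_s b -> standard_face v b.
Proof.
move=> hv bP le_b; apply/standard_faceP => //; split; first exact: root_polytopeP.
move=> i; rewrite inE => /eqP si; apply/le_anti/andP; split.
  by apply: polytope_coord_le; apply: root_polytopeP.
by rewrite -si; apply: root_le_coord.
Qed.

Lemma root_lexx b : root_le Pi b b.
Proof. by move=> i; rewrite subrr linear0. Qed.

(** The direction space is spanned by the simple roots outside [I]: coordinates in [I] are constant
    on the face, and by [root_chain] each such simple root is a difference of two roots of the
    face. *)
Lemma standard_face_dim v : coface_vector v ->
  affine_dim (standard_face v) (n - #|I|).
Proof.
move=> hv; have [thP th_max] := htheta.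
have th_s : root_le Pi theta_s theta by apply/th_max; exact: htheta_s.1.1.
pose X (A : {set 'I_n}) := [seq Pi`_j | j : 'I_n <- enum A].
have memX u : (u \in <<X (~: I)>>%VS) = [forall i in I, coord Pi i u == 0].
  apply/idP/forall_inP => [uX i iI|u0].
    have : (<<X (~: I)>> <= lker (linfun (coord Pi i : E -> R^o)))%VS.
      apply/span_subvP => _ /mapP[j jI ->]; move: jI; rewrite mem_enum finset.in_setC => jI.
      rewrite memv_ker lfunE /= (coord_simple hPi).
      by case: (eqVneq i j) jI => [<-|_ _]; rewrite ?iI ?eqxx.
    by move=> /subvP /(_ _ uX); rewrite memv_ker lfunE.
  rewrite [u](coordE hPi); apply: rpred_sum => i _.
  have [iI|iI] := boolP (i \in I); first by rewrite (eqP (u0 i iI)) scale0r mem0v.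
  by apply/rpredZ/memv_span/map_f; rewrite mem_enum finset.in_setC.
exists theta, <<X (~: I)>>%VS; split; last first.
  (* The two lists together rearrange the basis [Pi], so the first is free and its length is the
     dimension. *)
  have : free (X (~: I) ++ X I).
    rewrite /X -map_cat (perm_free (_ : perm_eq _ Pi)); last first.
      rewrite -[X in perm_eq _ X](map_tnth_enum Pi) (eq_map (tnth_nth 0 Pi)).
      apply/perm_map/uniq_perm; rewrite ?enum_uniq //.
        rewrite cat_uniq !enum_uniq andbT /=; apply/hasPn => i.
        by rewrite !mem_enum finset.in_setC => ->.
      by move=> i; rewrite mem_cat !mem_enum finset.in_setC orNb.
    exact: basis_free (rb_basis hPi).
  move/catl_free/eqnP ->.
  by rewrite size_map -cardE [LHS]cardsCs finset.setCK card_ord.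
apply/seteqP; split => x.
- move=> [k [t [p [Ap t1 xE]]]]; exists (x - theta); last by rewrite addrC subrK.
  rewrite /= memX; apply/forall_inP => i iI; rewrite linearB /= subr_eq0 xE.
  rewrite linear_sum -[eqbRHS]mul1r -t1 mulr_suml; apply/eqP/eq_bigr => j _.
  by rewrite linearZ /=; have /(standard_faceP _ hv)[_ ->] := Ap j.
- move=> [u /= uX <-].
  have -> : u = \sum_(i | i \notin I) coord Pi i u *: Pi`_i.
    rewrite [LHS](coordE hPi) (bigID (mem I)) /= big1 ?add0r // => i iI.
    by move: uX; rewrite memX => /forall_inP/(_ i iI)/eqP ->; rewrite scale0r.
  apply: affine_hull_add_sum.
    by apply: affine_hull_sub; apply: above_short_standard_face.
  move=> i; rewrite inE => neq.
  have [p [q [pP qP le_p le_q ->]]] : exists p q, [/\ p \in Phi, q \in Phi,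
      root_le Pi theta_s p, root_le Pi theta_s q & Pi`_i = p - q].
    by apply: (root_chain thP th_s); rewrite eq_sym.
  by exists p, q; split => //; apply: above_short_standard_face.
Qed.

Lemma standard_face_short v : coface_vector v -> short_face ip Phi (standard_face v).
Proof.
move=> hv; split; last first.
  exists theta_s; first exact: htheta_s.1.
  apply: above_short_standard_face => //; first exact: htheta_s.1.1.
  exact: root_lexx.
exists v, (ip v theta); split => // x Px; apply: polytope_ip_le => // i.
by rewrite hv ler0n.
Qed.

(* With [v] dominant defining [F] and [b] a short root in [F], the product with
   [v] is constant along [b <= theta_s <= theta], so [v] is orthogonal to the
   simple roots outside [I]. *)
Lemma standard_face_min v0 F : coface_vector v0 -> short_face ip Phi F ->
  exists2 w, weyl_group ip Phi w & standard_face v0 `<=` w @` F.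
Proof.
move=> hv0 [[v [c [Pc ->]]] [b sb [Pb /= vb]]].
have [w ww dw] := weyl_group_dominant hPhi hPi v.
have [thP th_max] := htheta.
exists w => //; rewrite (weyl_group_face hPhi) // => x.
move=> /(standard_faceP _ hv0)[Px xE]; split => //=.
have [w' [ww' wK w'K]] := weyl_group_inv hPhi ww.
have wvc y : P y -> ip (w v) y <= c.
  move=> Py; rewrite -(w'K y) (weyl_group_isometry hPhi) // Pc //.
  exact: (weyl_group_polytope hPhi).
(* The short root [w b] lies below [theta_s], and [w v] takes the value [c] on it. *)
have sc : c <= ip (w v) theta_s.
  rewrite -vb -(weyl_group_isometry hPhi v b ww).
  apply: (ip_dominant_le hPi) => //; apply: root_le_coord.
  exact/htheta_s.2/weyl_group_short.
have th_s : root_le Pi theta_s theta by apply/th_max; exact: htheta_s.1.1.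
have thc : ip (w v) theta = c.
  apply/le_anti/andP; split; first by apply: wvc; apply: root_polytopeP.
  apply: (le_trans sc).
  by apply: (ip_dominant_le hPi) => //; apply: root_le_coord.
(* Nonnegative terms with sum 0 all vanish, and outside [I] the coordinate of [theta - theta_s] is
   nonzero. *)
have wv0 i : i \notin I -> ip (w v) Pi`_i = 0.
  have pos j : 0 <= coord Pi j (theta - theta_s) * ip (w v) Pi`_j.
    by rewrite mulr_ge0 //; apply: natr_ge0 (th_s j).
  have sum0 : \sum_j coord Pi j (theta - theta_s) * ip (w v) Pi`_j = 0.
    apply/le_anti/andP; split; last by apply: sumr_ge0.
    rewrite (_ : \sum_j _ = ip (w v) (theta - theta_s)).
      by rewrite linearBr /= thc subr_le0.
    rewrite [in RHS](coordE hPi (theta - theta_s)) linear_sumr.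
    by apply: eq_bigr => j _; rewrite linearZr_LR.
  have x0 := psumr_eq0P (fun j _ => pos j) sum0.
  rewrite inE eq_sym => neq; apply/eqP; have /eqP := x0 i isT.
  by rewrite mulf_eq0 linearB /= subr_eq0 (negPf neq).
rewrite -thc [in LHS](coordE hPi x) [in RHS](coordE hPi theta) !linear_sumr.
apply: eq_bigr => i _; rewrite !linearZr_LR /=.
by have [/xE ->|/wv0 ->] := boolP (i \in I); rewrite ?mulr0.
Qed.

End StandardFace.

(** * Minimal dimension and the single orbit *)

Theorem proposition6p2 (R : realType) (E : vectType R) (ip : {dot E for idfun})
    (n : nat) (Phi : {fset E}) (Pi : n.-tuple E) (theta theta_s : E)
    (hPhi : root_system ip Phi) (hirr : irreducible_roots ip Phi)
    (hPi : root_basis Pi Phi) (hlaced : ~ simply_laced ip Phi)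
    (htheta : highest_root Pi Phi theta)
    (htheta_s : highest_short_root ip Pi Phi theta_s) :
  let d := (n - #|full_indices Pi theta theta_s|)%N in
  [/\ exists2 F, short_face ip Phi F & affine_dim F d,
      forall F d', short_face ip Phi F -> affine_dim F d' -> (d <= d')%N &
      exists F0, [set F | short_face ip Phi F /\ affine_dim F d]
                 = weyl_orbit ip Phi F0].
Proof.
move=> d.
have [v hv] := dual_vector ip hPi
  (fun i => (i \in full_indices Pi theta theta_s)%:R).
pose F0 := standard_face ip Phi theta v.
have F0s : short_face ip Phi F0 by apply: (standard_face_short hPi htheta htheta_s hv).
have F0d : affine_dim F0 d by apply: (standard_face_dim hPhi hPi htheta htheta_s hv).
have F0min F : short_face ip Phi F ->
    exists2 w, weyl_group ip Phi w & F0 `<=` w @` F.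
  exact: (standard_face_min hPhi hPi htheta htheta_s hv).
split; first by exists F0.
  move=> F d' /F0min[w ww F0w] /(weyl_group_affine_dim hPhi ww) wFd.
  by have [] := affine_dim_leqif F0w F0d wFd.
exists F0; apply/seteqP; split => F; last first.
  move=> [w ww <-]; split; first exact: (weyl_group_short_face hPhi).
  exact: (weyl_group_affine_dim hPhi).
move=> [Fs Fd]; have [w ww F0w] := F0min F Fs.
have [w' [ww' wK w'K]] := weyl_group_inv hPhi ww.
have [_ /(_ erefl) hull_eq] :=
  affine_dim_leqif F0w F0d (weyl_group_affine_dim hPhi ww Fd).
(* Then [F] is the image of [F0] under the inverse [w']. *)
suff wF : w @` F = F0.
  exists w' => //; rewrite -wF image_comp [X in image _ X](_ : _ = id) ?image_id //.
  by apply: funext => x /=; rewrite wK.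
apply/seteqP; split => // x wFx.
have Px : root_polytope Phi x.
  have [[u [c [_ FE]]] _] := weyl_group_short_face hPhi ww Fs.
  by move: wFx; rewrite FE => -[].
split => //=.
(* The equation defining [F0] in the polytope persists on its affine hull, which contains the image
   of [F] because the dimensions agree. *)
have : affine_hull F0 x by rewrite -hull_eq; apply: affine_hull_sub.
move=> [k [t [p [Ap t1 ->]]]]; rewrite linear_sumr.
rewrite -[RHS]mul1r -t1 mulr_suml; apply: eq_bigr => i _.
by rewrite linearZr_LR /=; have [_ /= ->] := Ap i.
Qed.
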